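(* Let $I\subset\mathbb{R}$ be an open interval and let $\alpha:I\to\mathbf{E}_1^3$ be a unit speed lightlike curve (i.e. parametrized by pseudo arc-length) whose torsion $\tau$ vanishes nowhere on $I$. Then $\alpha$ is a slant helix if and only if there exist real constants $a,b,c$ with $bs+c\neq0$ for all $s\in I$ such that $$\tau(s)=\frac{a}{(bs+c)^2}\qquad\text{for all } s\in I.$$
   Context: Minkowski 3-space $\mathbf{E}_1^3$ is $\mathbb{R}^3$ with the metric $\langle\,,\rangle=dx_1^2+dx_2^2-dx_3^2$. A vector $v$ is spacelike if $\langle v,v\rangle>0$ or $v=0$, timelike if $\langle v,v\rangle<0$, lightlike if $\langle v,v\rangle=0$ and $v\ne0$; $\|v\|=\sqrt{|\langle v,v\rangle|}$. Curves are smooth and regular. A curve is lightlike if all its velocity vectors are lightlike; a lightlike curve is unit speed (parametrized by pseudo arc-length) if $\alpha''(s)$ is spacelike with $\|\alpha''(s)\|=1$ for all $s$. Frenet frame of a unit speed lightlike curve: $\mathbf{T}=\alpha'$, $\mathbf{N}=\mathbf{T}'$, and $\mathbf{B}(s)$ is the unique lightlike vector orthogonal to $\mathbf{N}(s)$ with $\langle\mathbf{T}(s),\mathbf{B}(s)\rangle=1$. The torsion $\tau$ is the function determined by the Frenet equations $$\mathbf{T}'=\mathbf{N},\quad \mathbf{N}'=\tau\mathbf{T}-\mathbf{B},\quad \mathbf{B}'=-\tau\mathbf{N}.$$ A unit speed curve $\alpha$ is a slant helix if there exists a constant nonzero vector $U\in\mathbf{E}_1^3$ such that the function $s\mapsto\langle\mathbf{N}(s),U\rangle$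 is constant on $I$. A prime denotes $d/ds$. *)

(* Defs.v *)
From HB Require Import structures.
From mathcomp Require Import all_boot all_order all_algebra.
From mathcomp Require Import all_classical all_reals all_analysis.

Set Implicit Arguments.
Unset Strict Implicit.
Unset Printing Implicit Defensive.

Import Order.TTheory GRing.Theory Num.Theory.
Import numFieldNormedType.Exports.

Local Open Scope ring_scope.
Local Open Scope classical_set_scope.

Section Minkowski.
Variable R : realType.
Implicit Types u v : 'rV[R]_3.

(* The Lorentzian metric dx_1^2 + dx_2^2 - dx_3^2; the columns are numbered
   from 0, so the timelike coordinate is the last one. *)
Definition mprod u v : R :=
  u 0 0 * v 0 0 + u 0 1 * v 0 1 - u 0 ord_max * v 0 ord_max.

Definition mnorm v : R := Num.sqrt `|mprod v v|.

Definition spacelike v : Prop := 0 < mprod v v \/ v = 0.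

Definition lightlike v : Prop := mprod v v = 0 /\ v <> 0.

End Minkowski.

Section Curves.
Variable R : realType.

(* A curve on I is a total function of which only the values on I matter: on
   an open set I the derivatives at the points of I depend on these only. *)
Implicit Types (I : set R) (alpha : R -> 'rV[R]_3).

Definition smooth_on I alpha : Prop :=
  forall (n : nat) (s : R), I s -> derivable (alpha^`(n)) s 1.

Definition regular_on I alpha : Prop :=
  forall s : R, I s -> alpha^`() s <> 0.

Definition lightlike_curve I alpha : Prop :=
  [/\ smooth_on I alpha, regular_on I alpha &
      forall s : R, I s -> lightlike (alpha^`()%classic s)].

Definition unit_speed_lightlike I alpha : Prop :=
  lightlike_curve I alpha /\
  forall s : R, I s -> spacelike (alpha^`(2)%classic s) /\ mnorm (alpha^`(2)%classic s) = 1.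

Definition frenetT alpha : R -> 'rV[R]_3 := alpha^`().

Definition frenetN alpha : R -> 'rV[R]_3 := (frenetT alpha)^`().

(* [xget x0 P] is an element of P if there is one, and x0 otherwise.  When
   alpha is a unit speed lightlike curve on the open set I and s is in I, each
   of the two sets below has exactly one element. *)
Definition frenetB alpha (s : R) : 'rV[R]_3 :=
  xget 0 [set b | [/\ lightlike b, mprod b (frenetN alpha s) = 0 &
                      mprod (frenetT alpha s) b = 1]].

Definition torsion alpha (s : R) : R :=
  xget 0 [set t : R |
    [/\ (frenetT alpha)^`() s = frenetN alpha s,
        (frenetN alpha)^`() s = t *: frenetT alpha s - frenetB alpha s &
        (frenetB alpha)^`() s = - t *: frenetN alpha s]].

Definition slant_helix I alpha : Prop :=
  exists2 U : 'rV[R]_3, U <> 0 &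
    exists k : R, forall s : R, I s -> mprod (frenetN alpha s) U = k.

End Curves.

(* Main.v *)
Require Import Defs.
From HB Require Import structures.
From mathcomp Require Import all_boot all_order all_algebra.
From mathcomp Require Import all_classical all_reals all_analysis.
From mathcomp Require Import ring.

Set Implicit Arguments.
Unset Strict Implicit.
Unset Printing Implicit Defensive.

Import Order.TTheory GRing.Theory Num.Theory.
Import numFieldNormedType.Exports.

Local Open Scope ring_scope.
Local Open Scope classical_set_scope.

(** Write [f = <T,U>] and [g = <B,U>] for a constant vector [U]. If [<N,U> = k]
    is constant, the Frenet equations give [f' = k], [g = tau f] and
    [g' = - tau k], so [f] is affine and [(f g)' = 0]: thus [tau f^2 = f g] is
    constant. If [f] had a zero, this constant would be 0 and, as [tau <> 0],
    [f], [g] and [k] would vanish identically, forcing [U = 0]. Conversely, if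
    [tau = a / f^2] with [f = b s + c], then [(a / f) T + b N + f B] has zero
    derivative and is the required axis. *)

(** * Dual and null frames for the Lorentzian metric *)

Section Minkowski_frames.
Variable R : realType.
Implicit Types u v w : 'rV[R]_3.

Lemma mprodC u v : mprod u v = mprod v u.
Proof. by rewrite /mprod; ring. Qed.

Lemma mprodDr u v w : mprod u (v + w) = mprod u v + mprod u w.
Proof. by rewrite /mprod !mxE; ring. Qed.

Lemma mprodZr a u v : mprod u (a *: v) = a * mprod u v.
Proof. by rewrite /mprod !mxE; ring. Qed.

Lemma mprodNr u v : mprod u (- v) = - mprod u v.
Proof. by rewrite /mprod !mxE; ring. Qed.

Lemma mprod0r u : mprod u 0 = 0.
Proof. by rewrite /mprod !mxE; ring. Qed.

Lemma mprodDl u v w : mprod (v + w) u = mprod v u + mprod w u.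
Proof. by rewrite !(mprodC _ u) mprodDr. Qed.

Lemma mprodZl a u v : mprod (a *: v) u = a * mprod v u.
Proof. by rewrite !(mprodC _ u) mprodZr. Qed.

Lemma mprodNl u v : mprod (- v) u = - mprod v u.
Proof. by rewrite !(mprodC _ u) mprodNr. Qed.

Definition mprod_linr := (mprodDr, mprodNr, mprodZr).

Definition mprod_linl := (mprodDl, mprodNl, mprodZl).

(** Gram matrix of the metric, so that tables of products become matrix products. *)
Let J : 'M[R]_3 := diag_mx (\row_j if j == ord_max then -1 else 1).

Let mprodE m p (F : 'M[R]_(m, 3)) (G : 'M[R]_(p, 3)) i j :
  mprod (row i F) (row j G) = (F *m J *m G^T) i j.
Proof.
rewrite mxE !big_ord_recr big_ord0 /= mul_mx_diag !mxE /= /mprod !mxE.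
rewrite (_ : widen_ord _ (widen_ord _ _) = 0); last exact/val_inj.
by rewrite (_ : widen_ord _ _ = 1); [ring | exact/val_inj].
Qed.

(** Duality reads [F J G^T = 1]. The matrices are square, so also [G^T (F J) = 1], and applying this
    to [v^T] gives the expansion. *)
Lemma dual_frame_decomp (f g : 'I_3 -> 'rV[R]_3) v :
  (forall i j, mprod (f i) (g j) = (i == j)%:R) ->
  v = \sum_i mprod (f i) v *: g i.
Proof.
move=> fg; pose F := \matrix_i f i; pose G := \matrix_i g i.
have FG : F *m J *m G^T = 1%:M.
  by apply/matrixP => i j; rewrite -mprodE !rowK fg mxE.
apply: trmx_inj; rewrite -[LHS]mul1mx -(mulmx1C FG) -mulmxA.
apply/matrixP => i j; rewrite !mxE summxE; apply: eq_bigr => k _.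
by rewrite -mprodE rowK !ord1 row_id !mxE mulrC.
Qed.

End Minkowski_frames.

Section Null_frames.
Variable R : realType.
Implicit Types t n b v : 'rV[R]_3.

Record null_frame t n b : Prop := NullFrame {
  null_tt : mprod t t = 0;
  null_tn : mprod t n = 0;
  null_tb : mprod t b = 1;
  null_nn : mprod n n = 1;
  null_nb : mprod n b = 0;
  null_bb : mprod b b = 0 }.

(** The frame dual to [(t, n, b)] is [(b, n, t)]: the two null vectors trade places. *)
Lemma null_frame_decomp t n b v : null_frame t n b ->
  v = mprod b v *: t + mprod n v *: n + mprod t v *: b.
Proof.
case=> tt tn tb nn nb bb.
have := @dual_frame_decomp R (fun i => [:: t; n; b]`_i) (fun i => [:: b; n; t]`_i) v.
rewrite !big_ord_recr big_ord0 /= add0r => {1}->.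
  by rewrite addrC [X in _ + X]addrC addrA.
by case=> [[|[|[|//]]] ?] [[|[|[|//]]] ?] /=; rewrite // mprodC.
Qed.

End Null_frames.

Lemma mulf_sandwich_eq0 (F : idomainType) (a b : F) :
  a != 0 -> b * (a * b) = 0 -> b = 0.
Proof. by move=> a0 /eqP; rewrite !mulf_eq0 (negPf a0) orbb => /eqP. Qed.

(** * Calculus for curves and for functions on an interval *)

Section Derivation.
Variable R : realType.
Implicit Types (x : R) (f : R -> R) (u v : R -> 'rV[R]_3) (I : set R).

Lemma derive1P (V : normedModType R) (h : R -> V) x :
  derivable h x 1 -> is_derive x 1 h (h^`() x).
Proof. by rewrite derive1E => /derivableP. Qed.

Lemma is_derive_coord u x du i :
  is_derive x 1 u du -> is_derive x 1 (fun y => u y 0 i) (du 0 i).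
Proof.
move=> [ud <-]; apply: DeriveDef; first by move/derivable_mxP : ud; exact.
by rewrite derive_mx // mxE.
Qed.

Lemma is_derive_mprod u v x du dv :
  is_derive x 1 u du -> is_derive x 1 v dv ->
  is_derive x 1 (fun y => mprod (u y) (v y)) (mprod du (v x) + mprod (u x) dv).
Proof.
move=> ud vd; have uc i := is_derive_coord i ud; have vc i := is_derive_coord i vd.
have d i := is_deriveM (uc i) (vc i).
apply: is_derive_eq (is_deriveB (is_deriveD (d 0) (d 1)) (d ord_max)) _.
by rewrite /mprod /GRing.scale /=; ring.
Qed.

Lemma is_derive_mprodl u x du w :
  is_derive x 1 u du -> is_derive x 1 (fun y => mprod (u y) w) (mprod du w).
Proof.
move=> ud; apply: is_derive_eq (is_derive_mprod ud (is_derive_cst w _ _)) _.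
by rewrite mprod0r addr0.
Qed.

Lemma derivable_scaler f v x :
  derivable f x 1 -> derivable v x 1 -> derivable (fun y => f y *: v y) x 1.
Proof.
move=> fd /derivable_mxP vd; apply/derivable_mxP => i j.
have -> : (fun y => (f y *: v y) i j) = f * (fun y => v y i j).
  by apply/funext => y; rewrite mxE.
exact: derivableM fd (vd i j).
Qed.

(** As [I] is open, [f] agrees with a constant function near [x]. *)
Lemma is_derive_cst_on I f k x df : open I -> I x -> (forall y, I y -> f y = k) ->
  is_derive x 1 f df -> df = 0.
Proof.
move=> oI Ix fk fd.
have : is_derive x 1 (cst k) df.
  apply: near_eq_is_derive fd; apply: filterS (open_nbhs_nbhs (conj oI Ix)) => y.
  exact: fk.
by case=> _ <-; rewrite derive_cst.
Qed.

(** Mean value theorem on the segment between the two points, which lies in the interval [I]. *)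
Lemma is_derive0_on_cst I f : is_interval I ->
  (forall x, I x -> is_derive x 1 f 0) ->
  forall x y, I x -> I y -> f x = f y.
Proof.
move=> iI fd x y; wlog xy : x y / x <= y.
  by move=> H Ix Iy; have [/H|/ltW /H] := leP x y; [exact|move=> ->].
move=> Ix Iy; have sI z : z \in `[x, y]%R -> I z by rewrite in_itv; exact: iI.
have [| |c _] := @MVT_segment R f (fun=> 0) x y xy.
- by move=> z zxy; apply/fd/sI; move: zxy; rewrite !in_itv /= => /andP[/ltW-> /ltW->].
- apply: derivable_within_continuous => z zxy.
  by have [] := fd _ (sI _ zxy).
- by rewrite mul0r => /eqP; rewrite subr_eq0 => /eqP.
Qed.

End Derivation.

(** * The Frenet frame and the regularity of the torsion *)

Section Frenet.
Variables (R : realType) (I : set R) (alpha : R -> 'rV[R]_3).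
Hypothesis I_open : open I.
Hypothesis alpha_unit : unit_speed_lightlike I alpha.
Hypothesis torsion_neq0 : forall s : R, I s -> torsion alpha s <> 0.

Notation T := (frenetT alpha).
Notation N := (frenetN alpha).
Notation B := (frenetB alpha).
Notation tau := (torsion alpha).

Lemma is_derive_frenetT s : I s -> is_derive s 1 T (N s).
Proof. by move=> Is; apply: derive1P; have [[/(_ 1%N _ Is)]] := alpha_unit. Qed.

Lemma is_derive_frenetN_derive1 s : I s -> is_derive s 1 N (N^`()%classic s).
Proof. by move=> Is; apply: derive1P; have [[/(_ 2%N _ Is)]] := alpha_unit. Qed.

(* [torsion] defaults to 0 when no number satisfies the Frenet equations, so
   these come for free from [torsion_neq0]. *)
Lemma torsion_spec s : I s ->
  N^`()%classic s = tau s *: T s - B s /\ B^`()%classic s = - tau s *: N s.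
Proof.
move=> /torsion_neq0; rewrite /torsion; case: xgetP => // t _ [_ ? ?] _.
by split.
Qed.

Lemma mprodTT s : I s -> mprod (T s) (T s) = 0.
Proof. by case: alpha_unit => [[_ _ H] _] /H[]. Qed.

(** Unit norm leaves the values 1 and -1; being spacelike selects the sign. *)
Lemma mprodNN s : I s -> mprod (N s) (N s) = 1.
Proof.
case: alpha_unit => [_ H] /H[]; rewrite -[alpha^`(2)%classic s]/(N s) /mnorm => -[NN|N0].
  by move=> /(congr1 (fun x => x ^+ 2)); rewrite sqr_sqrtr // expr1n gtr0_norm.
by rewrite N0 mprod0r normr0 sqrtr0 => /esym/eqP; rewrite oner_eq0.
Qed.

Lemma mprodTN s : I s -> mprod (T s) (N s) = 0.
Proof.
move=> Is; have dT := is_derive_frenetT Is.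
have := is_derive_cst_on I_open Is mprodTT (is_derive_mprod dT dT).
rewrite (mprodC (N s)) -mulr2n => /eqP.
by rewrite mulrn_eq0 => /eqP.
Qed.

(** The point is that [frenetB] is not its default 0. Differentiating [<T,N> = 0] and inserting
    [N' = tau T - B] gives [<T,B> = 1], which excludes 0. *)
Lemma frenet_null_frame s : I s -> null_frame (T s) (N s) (B s).
Proof.
move=> Is; have TT := mprodTT Is; have TN := mprodTN Is; have NN := mprodNN Is.
have := is_derive_cst_on I_open Is mprodTN
  (is_derive_mprod (is_derive_frenetT Is) (is_derive_frenetN_derive1 Is)).
have [-> _] := torsion_spec Is; rewrite NN !mprod_linr TT mulr0 add0r => /eqP.
rewrite subr_eq0 => /eqP/esym.
rewrite /frenetB; case: xgetP => [b _ [[bb _] bN Tb] _|_ ].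
  by split => //; rewrite mprodC.
by rewrite mprod0r => /esym/eqP; rewrite oner_eq0.
Qed.

Lemma is_derive_frenetN s : I s -> is_derive s 1 N (tau s *: T s - B s).
Proof. by move=> Is; have [<- _] := torsion_spec Is; exact: is_derive_frenetN_derive1. Qed.

(** Since [T] and [B] are null with [<T,B> = 1], squaring [N' = tau T - B] leaves [-2 tau]. This
    expresses [tau] through derivatives of [alpha], hence its derivability. *)
Lemma torsionE s : I s ->
  tau s = - 2^-1 * mprod (N^`()%classic s) (N^`()%classic s).
Proof.
move=> Is; have [-> _] := torsion_spec Is; have [TT _ TB _ _ BB] := frenet_null_frame Is.
rewrite !(mprod_linl, mprod_linr) TT (mprodC (B s)) TB BB.
by field.
Qed.

Lemma derivable_derive_frenetN s : I s -> derivable (N^`()%classic) s 1.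
Proof. by move=> Is; have [[/(_ 3%N _ Is)]] := alpha_unit. Qed.

Lemma derivable_torsion s : I s -> derivable tau s 1.
Proof.
move=> Is; have dN' := derive1P (derivable_derive_frenetN Is).
have [d2 _] := is_derive_mprod dN' dN'.
apply: (@near_eq_derivable _ _ _ _ tau s 1 _ (derivableZ (k := - 2^-1) d2)).
apply: filterS (open_nbhs_nbhs (conj I_open Is)) => y Iy.
by rewrite torsionE.
Qed.

(** The Frenet equation gives only the value of the total operator at [B]. Derivability comes from
    [B = tau T - N'] near [s]. *)
Lemma is_derive_frenetB s : I s -> is_derive s 1 B (- tau s *: N s).
Proof.
move=> Is; have [_ <-] := torsion_spec Is; apply: derive1P.
have [dT _] := is_derive_frenetT Is.
have dB := derivableB (derivable_scaler (derivable_torsion Is) dT)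
  (derivable_derive_frenetN Is).
apply: (@near_eq_derivable _ _ _ _ B s 1 _ dB).
apply: filterS (open_nbhs_nbhs (conj I_open Is)) => y Iy.
rewrite /GRing.add /GRing.opp /=.
by have [-> _] := torsion_spec Iy; rewrite opprB addrC subrK.
Qed.

(** * Slant helices and the form of the torsion *)

Lemma slant_helix_torsion : is_interval I -> slant_helix I alpha ->
  exists a b c : R,
    (forall s : R, I s -> b * s + c <> 0) /\
    (forall s : R, I s -> tau s = a / (b * s + c) ^+ 2).
Proof.
move=> iI [U U0 [k Nk]].
have [[s0 Is0]|I0] := pselect (exists s, I s); last first.
  by exists 0, 0, 1; split=> s Is; case: I0; exists s.
pose f s := mprod (T s) U; pose g s := mprod (B s) U.
have df s : I s -> is_derive s 1 f k.
  by move=> Is; rewrite -(Nk s) //; exact: is_derive_mprodl (is_derive_frenetT Is).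
have gE s : I s -> g s = tau s * f s.
  move=> Is.
  have := is_derive_cst_on I_open Is Nk (is_derive_mprodl U (is_derive_frenetN Is)).
  rewrite !mprod_linl => /eqP.
  by rewrite subr_eq0 => /eqP.
have dg s : I s -> is_derive s 1 g (- tau s * k).
  move=> Is; rewrite -(Nk s) // -mprodZl.
  exact: is_derive_mprodl (is_derive_frenetB Is).
have fg_cst s : I s -> f s * g s = f s0 * g s0.
  move=> Is; apply: (@is_derive0_on_cst _ I (f * g)) => // x Ix.
  have ? := df _ Ix; have ? := dg _ Ix.
  by apply: is_derive_eq; rewrite gE // /GRing.scale /=; ring.
have fE s : I s -> f s = k * s + (f s0 - k * s0).
  move=> Is; have dh x : I x -> is_derive x 1 (f - k \*: id) 0.
    move=> Ix; have ? := df _ Ix.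
    by apply: is_derive_eq; rewrite /GRing.scale /= mulr1 subrr.
  have : f s - k * s = f s0 - k * s0 := is_derive0_on_cst iI dh Is Is0.
  by move=> <-; rewrite addrC subrK.
have f_neq0 s : I s -> f s <> 0.
  move=> Is fs0; have f0 x : I x -> f x = 0.
    move=> Ix; apply: (@mulf_sandwich_eq0 _ (tau x)); first exact/eqP/torsion_neq0.
    by rewrite -gE // fg_cst // -(fg_cst s) // fs0 mul0r.
  have k0 : k = 0 by exact: is_derive_cst_on I_open Is f0 (df _ Is).
  (* The components of [U] along [T], [N], [B] are [g], [k], [f], all zero at [s]. *)
  apply: U0; rewrite (null_frame_decomp U (frenet_null_frame Is)).
  by rewrite -/(f s) -/(g s) Nk // gE // f0 // k0 mulr0 !scale0r !addr0.
(* Here [b s + c] is [f] itself and [a] is the constant value of [f g = tau f^2]. *)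
exists (f s0 * g s0), k, (f s0 - k * s0); split=> s Is; rewrite -fE //.
  exact: f_neq0.
rewrite -(fg_cst s) // gE //; field; exact/eqP/f_neq0.
Qed.

Lemma torsion_slant_helix (a b c : R) : is_interval I ->
  (forall s : R, I s -> b * s + c <> 0) ->
  (forall s : R, I s -> tau s = a / (b * s + c) ^+ 2) -> slant_helix I alpha.
Proof.
move=> iI f0 tauE.
have [[s0 Is0]|I0] := pselect (exists s, I s); last first.
  exists (const_mx 1); last by exists 0 => s Is; case: I0; exists s.
  by move=> /matrixP/(_ 0 0)/eqP; rewrite !mxE oner_eq0.
pose f s : R := b * s + c.
(* The components are those that an axis with [<T,U> = f] and [<N,U> = b] must have, since then
   [<B,U> = tau f = a / f]. *)
pose U s := (a / f s) *: T s + b *: N s + f s *: B s.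
(* Coordinatewise, in [U'] the [T] terms cancel by [(a / f)' = - b tau], the [N] terms by
   [a / f = tau f], and the [B] terms by [f' = b]. *)
have U_cst s : I s -> U s = U s0.
  move=> Is; apply/rowP => i.
  apply: (@is_derive0_on_cst _ I (fun s => U s 0 i)) => // x Ix.
  have dT := is_derive_coord i (is_derive_frenetT Ix).
  have dN := is_derive_coord i (is_derive_frenetN Ix).
  have dB := is_derive_coord i (is_derive_frenetB Ix).
  have fx0 : f x != 0 by apply/eqP; exact: f0.
  have df : is_derive x 1 f b.
    rewrite (_ : f = b \*: id + cst c) //.
    by apply: is_derive_eq; rewrite /GRing.scale /=; ring.
  have dV : is_derive x 1 (fun y => a / f y) (- (a * b / f x ^+ 2)).
    apply: is_derive_eq (is_deriveZ a (is_deriveV fx0 df)) _.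
    by rewrite /GRing.scale /=; field.
  have dU := is_deriveD (is_deriveD (is_deriveM dV dT) (is_deriveZ b dN))
    (is_deriveM df dB).
  rewrite (_ : (fun _ => _) = (fun y => a / f y) * (fun y => T y 0 i) +
    b \*: (fun y => N y 0 i) + f * (fun y => B y 0 i)); last first.
    by apply/funext => y; rewrite /U !mxE.
  apply: is_derive_eq dU _; rewrite !mxE tauE // -/(f x) /GRing.scale /=.
  move: (f x) (T x 0 i) (N x 0 i) (B x 0 i) fx0 => y p q r y0.
  by field.
(* Pairing with [T] gives [f s0], nonzero, so [U s0] is nonzero; pairing with [N] gives [b]. *)
exists (U s0); last exists b => s Is.
  move=> Us0; have [TT TN TB _ _ _] := frenet_null_frame Is0.
  have := mprod0r (T s0); rewrite -Us0 !mprod_linr TT TN TB !mulr0 !add0r mulr1.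
  exact: f0.
have [_ TN _ NN NB _] := frenet_null_frame Is.
by rewrite -(U_cst s) // !mprod_linr mprodC TN NN NB !mulr0 add0r addr0 mulr1.
Qed.

End Frenet.

Theorem theorem1p4 (R : realType) (I : set R) (alpha : R -> 'rV[R]_3)
    (I_open : open I) (I_itv : is_interval I)
    (alpha_unit : unit_speed_lightlike I alpha)
    (torsion_neq0 : forall s : R, I s -> torsion alpha s <> 0) :
  slant_helix I alpha <->
  exists a b c : R,
    (forall s : R, I s -> b * s + c <> 0) /\
    (forall s : R, I s -> torsion alpha s = a / (b * s + c) ^+ 2).
Proof.
split; first exact: slant_helix_torsion.
by move=> [a [b [c [f0 tauE]]]]; exact: torsion_slant_helix tauE.
Qed.
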